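(* Let $\mathbb{B}_n$ be the Poincaré ball model of the $n$-dimensional hyperbolic space, with $\rho(x)=\ln\frac{1+|x|}{1-|x|}$ the geodesic distance from $x$ to $0$. Suppose that $n\ge4$ and $-2<\beta<n-4$. Then there exists a constant $C>0$ such that for every $f\in C_0^\infty(\mathbb{B}_n)$, $$\int_{\mathbb{B}_n}\frac{|\Delta_gf|^2}{\rho^\beta}\,dV_g\ge\frac{(n+\beta)^2(n-4-\beta)^2}{16}\int_{\mathbb{B}_n}\frac{|f|^2}{\rho^{\beta+4}}\,dV_g+3C\,\frac{(n-1)(n-2)(n+\beta)(n-4-\beta)}{4}\int_{\mathbb{B}_n}\frac{|f|^2}{\rho^{\beta+2}}\,dx .$$
   Context: $\mathbb{B}_n=\{x\in\mathbb{R}^n:|x|<1\}$ is equipped with the hyperbolic metric $g=\left(\frac{2}{1-|x|^2}\right)^2\sum_i dx_i^2$ (constant sectional curvature $-1$). Its volume measure is $dV_g=\left(\frac{2}{1-|x|^2}\right)^ndx$, where $dx$ is Lebesgue measure. The Laplace--Beltrami operator is $\Delta_g=\frac{(1-|x|^2)^2}{4}\Delta+(n-2)\frac{1-|x|^2}{2}\,x\cdot\nabla$. *)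

(* Defs.v *)
From HB Require Import structures.
From mathcomp Require Import all_boot all_order all_algebra.
From mathcomp Require Import all_classical all_reals all_analysis.

Set Implicit Arguments.
Unset Strict Implicit.
Unset Printing Implicit Defensive.

Import Order.TTheory GRing.Theory Num.Theory.
Import numFieldNormedType.Exports.

Local Open Scope classical_set_scope.
Local Open Scope ring_scope.

Definition measure_rV_display : measure_display.
Proof. exact: default_measure_display. Qed.

(* R^n carries the sigma-algebra generated by the coordinate functions, i.e.
   its Borel sigma-algebra. *)
Section measurable_rV.
Context (R : realType) (n : nat).

Let coord (i : 'I_n) (x : 'rV[R]_n) : measurableTypeR R := x ord0 i.

Let rV_set0 : g_sigma_preimage coord set0.
Proof. exact: sigma_algebra0. Qed.

Let rV_setC A : g_sigma_preimage coord A -> g_sigma_preimage coord (~` A).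
Proof. exact: sigma_algebraC. Qed.

Let rV_bigcup (F : _^nat) : (forall i, g_sigma_preimage coord (F i)) ->
  g_sigma_preimage coord (\bigcup_i (F i)).
Proof. exact: sigma_algebra_bigcup. Qed.

HB.instance Definition _ := @isMeasurable.Build measure_rV_display
  'rV[R]_n (g_sigma_preimage coord) rV_set0 rV_setC rV_bigcup.

Lemma measurable_coord (i : 'I_n) :
  measurable_fun [set: 'rV[R]_n]
    (fun x : 'rV[R]_n => x ord0 i : measurableTypeR R).
Proof.
move=> _ Y mY; rewrite setTI; apply: sub_sigma_algebra => /=.
rewrite -bigcup_seq/=; exists i => /=; first by rewrite mem_index_enum.
by exists Y => //; rewrite setTI.
Qed.

Lemma measurable_fun_coordP d (T : measurableType d) (f : T -> 'rV[R]_n) :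
  measurable_fun [set: T] f <->
  forall i, measurable_fun [set: T]
    (fun t => f t ord0 i : measurableTypeR R).
Proof.
split=> [mf i|mf].
  exact: (measurableT_comp (measurable_coord i) mf).
move=> _ A mA; rewrite setTI.
suff : g_sigma_preimage coord `<=` [set B | measurable (f @^-1` B)] by exact.
apply: smallest_sub.
  split => /=.
  - by rewrite preimage_set0; exact: measurable0.
  - by move=> B mB; rewrite setTD preimage_setC; exact: measurableC.
  - by move=> F mF; rewrite preimage_bigcup; exact: bigcup_measurable.
rewrite -bigcup_seq => _ [i _ [Y mY <-]] /=.
by rewrite setTI; have := mf i measurableT Y mY; rewrite setTI.
Qed.

End measurable_rV.

Section lebesgue_rV.
Context (R : realType).

Definition rV_cons n (p : measurableTypeR R * 'rV[R]_n) : 'rV[R]_n.+1 :=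
  row_mx (const_mx p.1 : 'rV[R]_1) p.2.

Lemma rV_cons0 n p : @rV_cons n p ord0 ord0 = p.1.
Proof.
rewrite (_ : ord0 = lshift n (ord0 : 'I_1)); last exact: val_inj.
by rewrite /rV_cons (row_mxEl (const_mx p.1 : 'rV[R]_1)) mxE.
Qed.

Lemma rV_consS n p (i : 'I_n) : @rV_cons n p ord0 (lift ord0 i) = p.2 ord0 i.
Proof.
rewrite (_ : lift ord0 i = rshift 1 i); last exact: val_inj.
by rewrite /rV_cons (row_mxEr (const_mx p.1 : 'rV[R]_1)).
Qed.

Lemma measurable_rV_cons n : measurable_fun setT (@rV_cons n).
Proof.
apply/measurable_fun_coordP => i.
case: (unliftP ord0 i) => [j ->|->].
  under eq_fun do rewrite rV_consS.
  exact: (measurableT_comp (measurable_coord j) measurable_snd).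
under eq_fun do rewrite rV_cons0.
exact: measurable_fst.
Qed.

Definition rV_uncons n (x : 'rV[R]_n.+1) : measurableTypeR R * 'rV[R]_n :=
  (x ord0 ord0, \row_j x ord0 (lift ord0 j)).

Lemma rV_consK n : cancel (@rV_cons n) (@rV_uncons n).
Proof.
move=> [a x]; rewrite /rV_uncons rV_cons0; congr pair.
by apply/rowP => j; rewrite mxE rV_consS.
Qed.

Lemma rV_unconsK n : cancel (@rV_uncons n) (@rV_cons n).
Proof.
move=> x; apply/rowP => i; case: (unliftP ord0 i) => [j ->|->].
  by rewrite rV_consS mxE.
by rewrite rV_cons0.
Qed.

Lemma measurable_rV_uncons n : measurable_fun setT (@rV_uncons n).
Proof.
apply: measurable_fun_pair => /=; first exact: (@measurable_coord R n.+1 ord0).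
apply/measurable_fun_coordP => i /=.
rewrite (_ : (fun _ => _) =
  (fun x : 'rV[R]_n.+1 => x ord0 (lift ord0 i) : measurableTypeR R)).
  exact: measurable_coord.
by apply/funext => x /=; rewrite mxE.
Qed.

Section lebesgue_cons.
Context (n : nat) (mu : {sigma_finite_measure set 'rV[R]_n -> \bar R}).

Definition lebesgue_cons : set 'rV[R]_n.+1 -> \bar R :=
  pushforward (@lebesgue_measure R \x mu)%E (@rV_cons n).

Let lebesgue_cons0 : lebesgue_cons set0 = 0%E.
Proof. by rewrite /lebesgue_cons /pushforward preimage_set0 measure0. Qed.

Let lebesgue_cons_ge0 A : (0 <= lebesgue_cons A)%E.
Proof. by rewrite /lebesgue_cons /pushforward; exact: measure_ge0. Qed.

Let lebesgue_cons_sigma_additive : semi_sigma_additive lebesgue_cons.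
Proof.
pose mc := isMeasurableFun.Build _ _ _ _ _ (@measurable_rV_cons n).
pose c : {mfun _ >-> _} := HB.pack (@rV_cons n) mc.
exact: (@measure_semi_sigma_additive _ _ _
  (pushforward (@lebesgue_measure R \x mu)%E c)).
Qed.

HB.instance Definition _ := isMeasure.Build _ _ _ lebesgue_cons
  lebesgue_cons0 lebesgue_cons_ge0 lebesgue_cons_sigma_additive.

Let lebesgue_cons_sigma_finite : sigma_finite setT lebesgue_cons.
Proof.
have /sigma_finiteP[F [TF ndF Foo]] := sigma_finiteT (@lebesgue_measure R).
have /sigma_finiteP[G [TG ndG Goo]] := sigma_finiteT mu.
exists (fun k => @rV_uncons n @^-1` (F k `*` G k)).
  apply/esym/seteqP; split => // x _.
  have [i _ Fi] : (\bigcup_i F i) (rV_uncons x).1 by rewrite -TF.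
  have [j _ Gj] : (\bigcup_j G j) (rV_uncons x).2 by rewrite -TG.
  exists (maxn i j) => //; split.
    by move: Fi; exact/subsetPset/ndF/leq_maxl.
  by move: Gj; exact/subsetPset/ndG/leq_maxr.
move=> k; have [mF Fk] := Foo k; have [mG Gk] := Goo k; split.
  rewrite -[X in measurable X]setTI; apply: measurable_rV_uncons => //.
  exact: measurableX.
rewrite /lebesgue_cons /pushforward -comp_preimage.
rewrite (_ : _ \o _ = id); last by apply/funext => p /=; rewrite rV_consK.
by rewrite preimage_id product_measure1E// lte_mul_pinfty// ge0_fin_numE.
Qed.

HB.instance Definition _ := Measure_isSigmaFinite.Build _ _ _ lebesgue_cons
  lebesgue_cons_sigma_finite.

End lebesgue_cons.

Fixpoint lebesgue_rV (n : nat) : {sigma_finite_measure set 'rV[R]_n -> \bar R} :=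
  if n is m.+1 then lebesgue_cons (lebesgue_rV m) else \d_(0 : 'rV[R]_0).

Lemma measurable_box n (A : 'I_n -> set (measurableTypeR R)) :
  (forall i, measurable (A i)) ->
  measurable [set x : 'rV[R]_n | forall i, A i (x ord0 i)].
Proof.
move=> mA; rewrite (_ : [set _ | _] = \bigcap_(i in [set: 'I_n])
    ((fun x : 'rV[R]_n => x ord0 i : measurableTypeR R) @^-1` A i)); last first.
  by apply/seteqP; split => x /= Ax i; [move=> _; exact: Ax|exact: Ax].
apply: fin_bigcap_measurable => [|i _]; first exact: finite_finset.
by rewrite -[X in measurable X]setTI; exact: measurable_coord.
Qed.

(* These values determine lebesgue_rV n: it is n-dimensional Lebesgue measure. *)
Lemma lebesgue_rV_box n (A : 'I_n -> set (measurableTypeR R)) :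
  (forall i, measurable (A i)) ->
  lebesgue_rV n [set x | forall i, A i (x ord0 i)] =
  (\prod_(i < n) lebesgue_measure (A i))%E.
Proof.
elim: n A => [|n IH] A mA.
  by rewrite big_ord0 /= diracE mem_set// => -[].
rewrite big_ord_recl -IH//.
rewrite -(product_measure1E lebesgue_measure (lebesgue_rV n) (mA ord0)
  (measurable_box (fun i => mA (lift ord0 i)))).
congr ((_ \x _)%E _); apply/seteqP; split => [p /= Ap|p [/= A0 AS] i].
  split => /= [|i]; first by rewrite -rV_cons0; exact: Ap.
  by rewrite -rV_consS; exact: Ap.
case: (unliftP ord0 i) => [j ->|->]; first by rewrite rV_consS; exact: AS.
by rewrite rV_cons0.
Qed.

End lebesgue_rV.

Section poincare_ball.
Context (R : realType) (n : nat).
Implicit Types (f F : 'rV[R]_n -> R) (x : 'rV[R]_n).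

(* The library norm `|x| on 'rV[R]_n is the sup norm. *)
Definition sqnorm x : R := \sum_(i < n) x ord0 i ^+ 2.
Definition enorm x : R := Num.sqrt (sqnorm x).

Definition poincare_ball : set 'rV[R]_n := [set x | enorm x < 1].

Definition partial (i : 'I_n) f : 'rV[R]_n -> R :=
  fun x => 'D_(delta_mx ord0 i) f x.

Definition iter_partial (s : seq 'I_n) f : 'rV[R]_n -> R := foldr partial f s.

(* 'D is total, so the existence of each derivative is required explicitly. *)
Definition smooth f : Prop := forall s : seq 'I_n,
  continuous (iter_partial s f) /\
  forall (i : 'I_n) x, derivable (iter_partial s f) x (delta_mx ord0 i).

Definition tsupport f : set 'rV[R]_n := closure [set x | f x != 0].

(* C_0^oo of the ball: a compactly supported smooth function on the open ball
   is identified with its extension by zero to R^n, which is smooth. *)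
Definition test_function f : Prop :=
  [/\ smooth f, compact (tsupport f) & tsupport f `<=` poincare_ball].

Definition laplacian f x : R := \sum_(i < n) partial i (partial i f) x.

Definition laplace_beltrami f x : R :=
  (1 - sqnorm x) ^+ 2 / 4 * laplacian f x +
  (n%:R - 2) * ((1 - sqnorm x) / 2) * \sum_(i < n) x ord0 i * partial i f x.

Definition geodesic_radius x : R := ln ((1 + enorm x) / (1 - enorm x)).

Definition integral_dx F : \bar R :=
  (\int[lebesgue_rV R n]_(x in poincare_ball) (F x)%:E)%E.

Definition integral_dVg F : \bar R :=
  integral_dx (fun x => F x * (2 / (1 - sqnorm x)) ^+ n).

End poincare_ball.

(* Main.v *)
(* Write phi = 2/(1-|x|^2), rho for the distance to 0, s = beta+2 and
   A = (n+beta)(n-4-beta)/4. The square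
     (rho^(-beta/2) Delta_g f + A rho^(-beta/2-2) f)^2 >= 0
   reduces the theorem to a lower bound for the integral of
   - f Delta_g f rho^(-s) dV_g. Integrating by parts and completing the square
   of grad f + (n-2-s)/2 f grad rho/rho, as in Hardy's inequality, bounds this
   integral below by that of
     f^2 rho^(-s-2) (A + (n-1)(n-2)/2 (rho coth rho - 1)) dV_g,
   and rho coth rho - 1 >= |x|^2 >= rho^2/(16 cosh^4(rho/2)), where
   dx = (2 cosh^2(rho/2))^(-n) dV_g with n >= 4; so C = 1/3 works.
   All boundary terms are the divergence of a single vector field, smooth off 0
   and with derivatives O(|x|^(-beta-4)), hence integrable as beta + 4 < n. The
   integral of its i-th term vanishes by Fubini: almost every line in the
   direction e_i misses the origin, and on such a line the fundamental theorem
   of calculus applies, so no cut-off around 0 is needed. *)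

Require Import Defs.
From mathcomp Require Import all_boot all_order all_algebra.
From mathcomp Require Import all_classical all_reals all_analysis.
From mathcomp Require Import measurable_realfun.
From mathcomp Require Import ring lra.

Set Implicit Arguments.
Unset Strict Implicit.
Unset Printing Implicit Defensive.

Import Order.TTheory GRing.Theory Num.Theory.
Import numFieldNormedType.Exports.

Local Open Scope classical_set_scope.
Local Open Scope ring_scope.

(** * Borel sets and line integrals in R^n *)

Section measure.
Context (R : realType).

(** A ball of the sup norm is a product of intervals. *)
Lemma measurable_rV_ball n (x : 'rV[R]_n) e : measurable (ball x e).
Proof.
(* A ball of matrices carries the condition [0 < e], which a product of intervals would lose when
   [n = 0]. *)
have [e0|e0] := ltP 0 e; last first.
  rewrite (_ : ball x e = set0); first exact: measurable0.
  by rewrite -subset0 => y [] /=; rewrite ltNge e0.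
rewrite (_ : ball x e = [set y | forall i, ball (x ord0 i) e (y ord0 i)]).
  apply: (@measurable_box R n (fun i => ball (x ord0 i) e)) => i.
  by rewrite ball_itv; exact: measurable_itv.
apply/seteqP; split => [y [_ xy] i|y xy]; first exact: xy.
by split => // i j; rewrite ord1; exact: xy.
Qed.

(** [U] is the union of the countably many balls inside it with rational centre and radius
    [1 / (k + 1)]. A radius below [e / 2] keeps such a ball around [x] within the ball of radius
    [e]. *)
Lemma open_measurable_rV n (U : set 'rV[R]_n) : open U -> measurable U.
Proof.
move=> oU.
pose c (q : 'rV[rat]_n) : 'rV[R]_n := map_mx ratr q.
pose B (p : 'rV[rat]_n * nat) : set 'rV[R]_n :=
  if pselect (ball (c p.1) p.2.+1%:R^-1 `<=` U) then
    ball (c p.1) p.2.+1%:R^-1 else set0.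
rewrite (_ : U = \bigcup_p B p); last first.
  apply/seteqP; split => [x Ux|x [p _]]; last first.
    by rewrite /B; case: pselect => // BU; exact: BU.
  have /nbhs_ballP[e /= e0 xeU] : nbhs x U by exact: open_nbhs_nbhs.
  have e20 : 0 < e / 2 by rewrite divr_gt0.
  have [k ke] : exists k, k.+1%:R^-1 < e / 2.
    exists (Num.truncn (e / 2)^-1).
    by rewrite invf_plt ?posrE// truncnS_gt.
  have kp : 0 < k.+1%:R^-1 :> R by rewrite invr_gt0.
  have xk (y : R) : y - k.+1%:R^-1 < y + k.+1%:R^-1.
    by rewrite ltrD2l; apply: lt_trans kp; rewrite oppr_lt0.
  have /choice[q qP] : forall i : 'I_n, exists q : rat,
      ball (x ord0 i) k.+1%:R^-1 (ratr q).
    move=> i; have [q] := rat_in_itvoo (xk (x ord0 i)).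
    rewrite in_itv/= => /andP[q1 q2]; exists q.
    by rewrite /ball/= ltr_distl ltrBlDr q2 -ltrBlDr.
  have xb : ball (c (\row_i q i)) k.+1%:R^-1 x.
    split => // i j; rewrite ord1 !mxE; apply: ball_sym; exact: qP.
  exists ((\row_i q i), k) => //; rewrite /B /=; case: pselect => //; apply.
  move=> y yb; apply: xeU; rewrite [e]splitr.
  apply: le_ball (ball_triangle (ball_sym xb) yb).
  by rewrite lerD// ltW.
apply: countable_bigcupT_measurable => [|p]; first exact: countableP.
rewrite /B; case: pselect => [?|?]; first exact: measurable_rV_ball.
exact: measurable0.
Qed.

Lemma closed_rV_set1 n (x : 'rV[R]_n) : closed [set x].
Proof. exact/accessible_closed_set1/hausdorff_accessible/norm_hausdorff. Qed.

Lemma measurable_rV_set1 n (x : 'rV[R]_n) : measurable [set x].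
Proof.
rewrite -[X in measurable X]setCK; apply: measurableC.
by apply: open_measurable_rV; apply: closed_openC; exact: closed_rV_set1.
Qed.

(** The preimage of an open interval is open up to the single point 0, where the weights used below
    are singular. *)
Lemma continuous_off0_measurable n (F : 'rV[R]_n -> R) :
  (forall x, x != 0 -> {for x, continuous F}) -> measurable_fun setT F.
Proof.
have c0 := @closed_rV_set1 n 0; have m0 := @measurable_rV_set1 n 0.
move=> cF; apply: (measurability _ (RGenOpens.measurableE R)) => //.
move=> _ [_ [a [b ->] <-]]; rewrite setTI.
set U := _ @^-1` _.
have oU : open (U `&` ~` [set 0]).
  rewrite openE => x [Ux /eqP x0]; apply: filterI.
    apply: (cF x x0); apply: open_nbhs_nbhs; split => //; exact: interval_open.
  by apply: open_nbhs_nbhs; split; [exact: closed_openC|exact/eqP].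
rewrite -(setUIDK U [set 0]) setDE; apply: measurableU; last exact: open_measurable_rV.
have [U0|U0] := pselect (U 0).
  by rewrite (_ : U `&` _ = [set 0])//; apply/seteqP; split => [x []|x ->].
rewrite (_ : U `&` _ = set0)//.
by apply/seteqP; split => [x [Ux x0]|x]//; apply: U0; rewrite -x0.
Qed.

End measure.

Section fubini.
Context (R : realType).
Local Notation lambda := (@lebesgue_measure R).

Lemma measurable_rV_coord_eq0 n (i : 'I_n) :
  measurable [set x : 'rV[R]_n | x ord0 i = 0].
Proof.
have := @measurable_coord R n i measurableT [set 0] (measurable_set1 _).
by rewrite setTI.
Qed.

Lemma lebesgue_rV_coord_eq0 n (i : 'I_n) :
  lebesgue_rV R n [set x | x ord0 i = 0] = 0%E.
Proof.
pose A (j : 'I_n) : set (measurableTypeR R) := if j == i then [set 0] else setT.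
have mA j : measurable (A j).
  by rewrite /A; case: ifP => _; [exact: measurable_set1|exact: measurableT].
rewrite (_ : [set x | _] = [set x | forall j, A j (x ord0 j)]); last first.
  apply/seteqP; split => [x xi j|x /(_ i)]; last by rewrite /A eqxx.
  by rewrite /A; case: ifP => [/eqP ->|].
rewrite lebesgue_rV_box// (bigD1 i)//= /A eqxx.
by rewrite [X in (X * _)%E]lebesgue_measure_set1 mul0e.
Qed.

Lemma ae_rV_coords_neq0 n :
  {ae lebesgue_rV R n, forall (x : 'rV[R]_n), forall j : 'I_n, x ord0 j != 0}.
Proof.
(* The coordinate hyperplanes are indexed by all naturals to fit a countable union; indices [k >= n]
   contribute the empty set. *)
have := @negligible_bigcup _ _ _ (lebesgue_rV R n)
  (fun k => [set x : 'rV[R]_n | exists2 j : 'I_n, j = k :> nat & x ord0 j = 0]).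
move=> /(_ _)[k|B [mB B0 sB]].
  have [kn|kn] := ltnP k n; last first.
    rewrite (_ : [set x | _] = set0); first exact: negligible_set0.
    by apply/seteqP; split => // x [j jk _]; move: kn; rewrite -jk leqNgt ltn_ord.
  exists [set x : 'rV[R]_n | x ord0 (Ordinal kn) = 0]; split.
  - exact: measurable_rV_coord_eq0.
  - exact: lebesgue_rV_coord_eq0.
  - by move=> x [j jk]; rewrite (_ : Ordinal kn = j)//; exact: val_inj.
exists B; split => // x /= /existsNP[j /negP]; rewrite negbK => /eqP xj.
by apply: sB; exists (nat_of_ord j) => //=; exists j.
Qed.

Lemma integrable_rV_cons n (G : 'rV[R]_n.+1 -> \bar R) :
  (lebesgue_rV R n.+1).-integrable setT G ->
  (lambda \x lebesgue_rV R n)%E.-integrable setT (G \o @rV_cons R n).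
Proof.
move=> /integrableP[mG Goo]; apply/integrableP; split.
  by apply: measurableT_comp => //; exact: measurable_rV_cons.
move: Goo; rewrite /= [X in (X < _)%E](_ : _ =
    (\int[pushforward (lambda \x lebesgue_rV R n)%E (@rV_cons R n)]_x `|G x|)%E)//.
rewrite ge0_integral_pushforward//.
- exact: measurable_rV_cons.
- exact: measurableT_comp.
Qed.

(** By construction the measure in dimension [n.+1] is the image of a product measure under
    [rV_cons], so this is the change of variables for image measures. *)
Lemma integral_rV_cons n (G : 'rV[R]_n.+1 -> \bar R) :
  (lebesgue_rV R n.+1).-integrable setT G ->
  (\int[lebesgue_rV R n.+1]_x G x =
   \int[lambda \x lebesgue_rV R n]_p G (rV_cons p))%E.
Proof.
move=> iG.
rewrite [LHS](_ : _ =
    (\int[pushforward (lambda \x lebesgue_rV R n)%E (@rV_cons R n)]_x G x)%E)//.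
rewrite integral_pushforward//.
- exact: measurable_rV_cons.
- by case/integrableP: iG.
- exact: integrable_rV_cons.
Qed.

Lemma rV_consDl n t (x : 'rV[R]_n) :
  rV_cons (t, x) = rV_cons (0 : measurableTypeR R, x) + t *: delta_mx ord0 ord0.
Proof.
apply/rowP => j; rewrite [RHS]mxE; case: (unliftP ord0 j) => [k ->|->].
  by rewrite !rV_consS !mxE/= mulr0 addr0.
by rewrite !rV_cons0 !mxE/= mulr1 add0r.
Qed.

Lemma rV_consDr n (u t : R) (x : 'rV[R]_n) i :
  rV_cons (u : measurableTypeR R, x + t *: delta_mx ord0 i) =
  rV_cons (u : measurableTypeR R, x) + t *: delta_mx ord0 (lift ord0 i).
Proof.
apply/rowP => j; rewrite [RHS]mxE; case: (unliftP ord0 j) => [k ->|->].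
  by rewrite !rV_consS !mxE/= (inj_eq lift_inj).
by rewrite !rV_cons0 !mxE/= mulr0 addr0.
Qed.

(* Asking for nonzero coordinates, rather than just for lines missing the origin,
   makes the hypothesis stable under the induction on the dimension. *)
Lemma integral_lines_eq0 n (i : 'I_n) (G : 'rV[R]_n -> \bar R) :
  (lebesgue_rV R n).-integrable setT G ->
  (forall x : 'rV[R]_n, x ord0 i = 0 -> (forall j, j != i -> x ord0 j != 0) ->
    (\int[lambda]_t G (x + t *: delta_mx ord0 i)%R)%E = 0%E) ->
  (\int[lebesgue_rV R n]_x G x)%E = 0%E.
Proof.
elim: n i G => [[]//|n IH] i G iG G0.
have iGc := integrable_rV_cons iG.
rewrite integral_rV_cons//.
case: (unliftP ord0 i) => [i' i'E|i0].
  (* The direction lies in the tail: the first coordinate [t] is fixed and the induction hypothesis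
     is applied to the slice. Discarding [t = 0] keeps the coordinates other than [i] nonzero, as
     [G0] requires. *)
  rewrite -integral12_prod_meas1//.
  rewrite (@ae_eq_integral _ _ _ lambda setT (cst 0%E))//.
  - by rewrite integral0.
  - exact: (measurable_fubini_F iGc).
  - have N0 : {ae lambda, forall t : measurableTypeR R, t != 0}.
      exists [set 0]; split; first exact: measurable_set1.
        exact: lebesgue_measure_set1.
      by move=> t /= /negP; rewrite negbK => /eqP.
    apply: filterS2 N0 (ae_integrable1 iGc).
    move=> t tN0 it _ /=; rewrite /fubini_F/=.
    apply: (IH i') => // x xi xN0.
    under eq_integral do rewrite rV_consDr -i'E.
    apply: G0; first by rewrite i'E rV_consS.
    move=> j; case: (unliftP ord0 j) => [k ->|->]; last by rewrite rV_cons0.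
    by rewrite i'E (inj_eq lift_inj) rV_consS; exact: xN0.
(* The direction is the first coordinate: with the tail as outer variable, the inner integral is the
   line integral itself. *)
rewrite -integral21_prod_meas1//.
rewrite (@ae_eq_integral _ _ _ (lebesgue_rV R n) setT (cst 0%E))//.
- by rewrite integral0.
- exact: (measurable_fubini_G iGc).
- apply: filterS (@ae_rV_coords_neq0 n) => x xN0 _ /=; rewrite /fubini_G/=.
  under eq_integral do rewrite rV_consDl -i0.
  apply: G0; first by rewrite i0 rV_cons0.
  move=> j; rewrite i0; case: (unliftP ord0 j) => [k ->|->].
    by rewrite rV_consS.
  by rewrite eqxx.
Qed.

End fubini.

(** * Integrability of |x|^(-a) near the origin for a < n *)

Section dyadic.
Context (R : realType).

Lemma le_coord_mx_norm n (x : 'rV[R]_n) i : `|x ord0 i| <= `|x|.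
Proof.
rewrite [leRHS]/Num.norm/= mx_normrE.
exact: (le_bigmax _ (fun ij : 'I_1 * 'I_n => `|x ij.1 ij.2|) (ord0, i)).
Qed.

Definition cube n (k : nat) : set 'rV[R]_n :=
  [set x | forall i, `[- 2 ^- k, 2 ^- k]%classic (x ord0 i)].

Lemma measurable_cube n k : measurable (@cube n k).
Proof.
exact: (@measurable_box R n (fun=> `[- 2 ^- k, 2 ^- k]%classic)).
Qed.

Lemma lebesgue_cube n k : lebesgue_rV R n (@cube n k) = ((2 * 2 ^- k) ^+ n)%:E.
Proof.
have k0 : 0 < 2 ^- k :> R by rewrite invr_gt0 exprn_gt0.
rewrite (lebesgue_rV_box (A := fun=> `[- 2 ^- k, 2 ^- k]%classic))//.
under eq_bigr do rewrite lebesgue_measure_itv/= lte_fin gtrN//.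
rewrite (eq_bigr (fun=> (2 * 2 ^- k)%:E)) => [|_ _]; last first.
  by rewrite -EFinB opprK mulr_natl mulr2n.
by rewrite prodEFin prodr_const card_ord.
Qed.

(** The least [k] with [2 ^- k.+1 < y] works: minimality gives the upper bound, except for [k = 0],
    where [y <= 1] does. *)
Lemma dyadic_layer (y : R) : 0 < y -> y <= 1 ->
  exists k, 2 ^- k.+1 < y <= 2 ^- k.
Proof.
move=> y0 y1.
have ex : exists k, 2 ^- k.+1 < y.
  exists (Num.truncn y^-1); rewrite invf_plt ?posrE ?exprn_gt0//.
  apply: lt_trans (truncnS_gt _) _; rewrite -natrX ltr_nat.
  exact: ltn_expl.
have := ex_minnP ex; case: ex_minnP => k yk kmin _; exists k; rewrite yk /=.
case: k yk kmin => [|k] yk kmin; first by rewrite expr0 invr1.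
by rewrite leNgt; apply/negP => /kmin; rewrite ltnn.
Qed.

(* [F] is dominated by a geometric series of indicators of dyadic cubes. At the
   origin the hypothesis forces [F 0 = 0], since [0 `^ (- a) = 0]. *)
Lemma integrable_dominated_powR n (a M : R) (F : 'rV[R]_n -> R) :
  0 < a -> a < n%:R -> 0 <= M -> measurable_fun setT F ->
  (forall x, `|x| <= 1 -> `|F x| <= M * `|x| `^ (- a)) ->
  (forall x, 1 < `|x| -> F x = 0) ->
  (lebesgue_rV R n).-integrable setT (EFin \o F).
Proof.
move=> a0 an M0 mF Fle F0.
pose q : R := 2 `^ a.
have q0 : 0 < q by rewrite powR_gt0.
have qn : q < 2 ^+ n.
  rewrite -powR_mulrn// /q /powR pnatr_eq0/= ltr_expR ltr_pM2r//.
  by rewrite ln_gt0// ltr1n.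
(* On the layer [2 ^- k.+1 < |x| <= 2 ^- k] one has [M |x|^(-a) <= c k], and the cube containing
   this layer has measure [(2 * 2 ^- k) ^+ n]. The integrals of the terms thus form a geometric
   series of ratio [q / 2 ^+ n < 1]. *)
pose c k : R := M * q ^+ k.+1.
have c0 k : 0 <= c k by rewrite mulr_ge0// exprn_ge0// ltW.
pose D x := (\sum_(0 <= k <oo) (c k * \1_(@cube n k) x)%:E)%E.
have u0 k x : (0 <= (c k * \1_(@cube n k) x)%:E)%E by rewrite lee_fin mulr_ge0.
have mu k : measurable_fun setT (fun x => (c k * \1_(@cube n k) x)%:E).
  apply/measurable_EFinP; apply: measurable_funM => //.
  by apply: measurable_indic; exact: measurable_cube.
have mD : measurable_fun setT D by apply: ge0_emeasurable_sum.
have Doo : (\int[lebesgue_rV R n]_x D x < +oo)%E.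
  rewrite integral_nneseries//.
  apply: (@le_lt_trans _ _ ((M * q * 2 ^+ n) / (1 - q / 2 ^+ n))%:E); last first.
    exact: ltry.
  apply: lime_le.
    by apply: is_cvg_nneseries => k _ _; apply: integral_ge0.
  apply: nearW => m.
  rewrite (eq_bigr (fun k => (geometric (M * q * 2 ^+ n) (q / 2 ^+ n) k)%:E)).
    rewrite sumEFin lee_fin; apply: geometric_le_lim.
    - by rewrite !mulr_ge0// ltW.
    - by rewrite divr_gt0// exprn_gt0.
    - by rewrite ger0_norm ?divr_ge0 ?ltW// ltr_pdivrMr ?mul1r// exprn_gt0.
  move=> k _; under eq_integral do rewrite EFinM.
  rewrite ge0_integralZl_EFin//.
  - rewrite integral_indic//; last exact: measurable_cube.
    rewrite setIT [X in (_ * X)%E](lebesgue_cube n k) -EFinM; congr EFin.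
    rewrite /c /= exprS exprMn exprMn -[2 ^- k]exprVn -!exprM [(k * n)%N]mulnC.
    by rewrite exprM exprVn; ring.
  - apply/measurable_EFinP; apply: measurable_indic; exact: measurable_cube.
apply/integrableP; split; first exact/measurable_EFinP.
apply: le_lt_trans Doo; apply: ge0_le_integral => //.
  by apply/measurable_EFinP; exact: measurableT_comp.
move=> x _ /=; have [x1|x1] := leP `|x| 1; last first.
  by rewrite F0// normr0; apply: nneseries_ge0.
have [x0|x0] := eqVneq `|x| 0.
  apply: (@le_trans _ _ 0%E); last by apply: nneseries_ge0.
  rewrite lee_fin (le_trans (Fle _ x1))// x0 powR0 ?mulr0//.
  by rewrite oppr_eq0 gt_eqF.
have {}x0 : 0 < `|x| by rewrite lt_def x0/=.
have [k /andP[kx xk]] := dyadic_layer x0 x1.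
(* Only the [k]-th term of the series is kept. *)
apply: le_trans (nneseries_lim_ge k.+1 _) => //.
rewrite big_nat_recr//= -[leLHS]add0e leeD//.
  by apply: sume_ge0 => j _.
rewrite indicE mem_set; last first.
  by move=> i; rewrite /= in_itv/= -ler_norml (le_trans (le_coord_mx_norm _ _)).
rewrite mulr1 lee_fin (le_trans (Fle _ x1))// /c ler_wpM2l//.
rewrite powRN -[leRHS]invrK lef_pV2 ?posrE ?invr_gt0 ?exprn_gt0 ?powR_gt0//.
rewrite (_ : (q ^+ k.+1)^-1 = (2 ^- k.+1) `^ a).
  by apply: ge0_ler_powR; rewrite ?nnegrE ?(ltW a0) ?(ltW kx)// invr_ge0 exprn_ge0.
have -> : 2 ^- k.+1 = 2 `^ (- k.+1%:R) :> R by rewrite powRN powR_mulrn.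
by rewrite -powRrM mulNr [k.+1%:R * a]mulrC powRN powRrM powR_mulrn// ltW.
Qed.

End dyadic.

(** * The geodesic radius *)

Section radial.
Context (R : realType).
Implicit Types r t : R.

(** This is [2 artanh r]; [geodesic_radius x] is [hdist (enorm x)] by conversion, so one-variable
    calculus applies to it. *)
Definition hdist r : R := ln ((1 + r) / (1 - r)).

Lemma is_derive_hdist r : -1 < r -> r < 1 ->
  is_derive r 1 hdist (2 / (1 - r ^+ 2)).
Proof.
move=> r1 r2.
have r1r : 1 - r != 0 by rewrite subr_eq0 gt_eqF.
have r1r' : 1 + r != 0 by rewrite addrC -[1]opprK subr_eq0 gt_eqF.
have p0 : 0 < (1 + r) / (1 - r) by rewrite divr_gt0; lra.
have dq : is_derive r 1 (fun x : R => (1 + x) / (1 - x)) (2 / (1 - r) ^+ 2).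
  have d1 : is_derive r 1 (fun x : R => 1 + x) 1.
    by apply: is_derive_eq; rewrite /GRing.scale/=; ring.
  have d2 : is_derive r 1 (fun x : R => 1 - x) (-1).
    by apply: is_derive_eq; rewrite /GRing.scale/=; ring.
  have d3 := @is_deriveV R _ r (-1) 1 r1r d2.
  apply: (is_derive_eq (is_deriveM d1 d3)).
  by rewrite /GRing.scale/=; field.
have dl := @is_derive1_comp R (@ln R) _ r _ _ (is_derive1_ln p0) dq.
apply: (is_derive_eq dl).
have -> : 1 - r ^+ 2 = (1 - r) * (1 + r) by ring.
by field; rewrite r1r r1r'.
Qed.

Lemma hdist0 : hdist 0 = 0.
Proof. by rewrite /hdist addr0 subr0 divr1 ln1. Qed.

(** [hdist r - 2 r] vanishes at 0 and has derivative [2 / (1 - r^2) - 2 >= 0]. *)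
Lemma hdist_ge r : 0 <= r -> r < 1 -> 2 * r <= hdist r.
Proof.
move=> r0 r1.
pose h := fun x : R => hdist x - 2 * x.
have dh (x : R) : 0 <= x -> x < 1 -> is_derive x 1 h (2 / (1 - x ^+ 2) - 2).
  move=> x0 x1; have xN1 : -1 < x by lra.
  have := is_derive_hdist xN1 x1 => ?.
  have d2 : is_derive x 1 (fun x : R => 2 * x) 2.
    by apply: is_derive_eq; rewrite /GRing.scale/=; ring.
  exact: is_deriveB.
have ch : {within `[0, r], continuous h}.
  apply: derivable_within_continuous => x; rewrite in_itv/= => /andP[x0 xr].
  by have [] := dh x x0 (le_lt_trans xr r1).
have xP (x : R) : x \in `]0, r[ -> 0 <= x /\ x < 1.
  by rewrite in_itv/= => /andP[x0 xr]; split; lra.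
suff : h 0 <= h r by rewrite /h hdist0 mulr0 subr0 subr_ge0.
apply: (@ger0_derive1_ndecr R h 0 r _ _ ch 0 r (lexx _) r0 (lexx _)).
- by move=> x /xP[x0 x1]; have [] := dh x x0 x1.
- move=> x /xP[x0 x1]; rewrite derive1E; have [_ ->] := dh x x0 x1.
  rewrite subr_ge0 ler_pdivlMr; last by rewrite subr_gt0 expr_lt1.
  by rewrite ler_piMr// gerBl sqr_ge0.
Qed.

(** Apply [ln (1 + y) <= y] with [y = 2 r / (1 - r)], then use [1 + r <= 2]. *)
Lemma hdist_le r : 0 <= r -> r < 1 -> hdist r <= 4 * r / (1 - r ^+ 2).
Proof.
move=> r0 r1.
have p0 : 0 < (1 + r) / (1 - r) by rewrite divr_gt0; lra.
have r2 : 0 < 1 - r by lra.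
have r3 : 0 < 1 + r by lra.
rewrite /hdist -[X in ln X](subrK 1) addrC (le_trans (le_ln1Dx _))//.
  by rewrite ltrBrDr addNr.
have -> : (1 + r) / (1 - r) - 1 = 2 * r / (1 - r) by field; rewrite gt_eqF.
have -> : 4 * r / (1 - r ^+ 2) = 2 * r / (1 - r) * (2 / (1 + r)).
  have -> : 1 - r ^+ 2 = (1 - r) * (1 + r) by ring.
  by field; rewrite !gt_eqF.
rewrite ler_peMr ?divr_ge0 ?mulr_ge0 ?(ltW r2)// ler_pdivlMr//; lra.
Qed.

End radial.

(** * The conformal factor and functions bounded near the origin *)

Section weights.
Context (R : realType) (n : nat).
Implicit Types (x : 'rV[R]_n) (Q F : 'rV[R]_n -> R) (K : set 'rV[R]_n).

Lemma sqnorm_ge0 x : 0 <= sqnorm x.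
Proof. by apply: sumr_ge0 => i _; exact: sqr_ge0. Qed.

Lemma sqr_enorm x : enorm x ^+ 2 = sqnorm x.
Proof. by rewrite sqr_sqrtr// sqnorm_ge0. Qed.

Lemma enorm_ge0 x : 0 <= enorm x.
Proof. exact: sqrtr_ge0. Qed.

Lemma le_coord_enorm x i : `|x ord0 i| <= enorm x.
Proof.
rewrite -sqrtr_sqr ler_wsqrtr// /sqnorm (bigD1 i)//= lerDl.
by apply: sumr_ge0 => j _; exact: sqr_ge0.
Qed.

Lemma mx_norm_le_enorm x : `|x| <= enorm x.
Proof.
rewrite [leLHS]/Num.norm/= mx_normrE; apply: bigmax_le; first exact: enorm_ge0.
by move=> [i j] _ /=; rewrite ord1; exact: le_coord_enorm.
Qed.

Lemma enorm_gt0 x : x != 0 -> 0 < enorm x.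
Proof. by move=> x0; apply: lt_le_trans (mx_norm_le_enorm x); rewrite normr_gt0. Qed.

Lemma enorm0 : enorm (0 : 'rV[R]_n) = 0.
Proof.
by rewrite /enorm /sqnorm big1 ?sqrtr0// => i _; rewrite mxE expr0n.
Qed.

Lemma sqnorm_lt1 x : poincare_ball x -> sqnorm x < 1.
Proof. by move=> xB; rewrite -sqr_enorm expr_lt1// enorm_ge0. Qed.

Definition conformal x : R := 2 / (1 - sqnorm x).

Lemma conformal_ge2 x : poincare_ball x -> 2 <= conformal x.
Proof.
move=> /sqnorm_lt1 x1; rewrite ler_pdivlMr ?subr_gt0//.
by rewrite ler_piMr// gerBl sqnorm_ge0.
Qed.

Lemma continuous_sqnorm : continuous (@sqnorm R n).
Proof.
apply: continuous_big => [|i _ x]; first exact: add_continuous.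
have ci := @coord_continuous R 1 n ord0 i x.
exact: (continuousM ci ci).
Qed.

Lemma continuous_enorm : continuous (@enorm R n).
Proof.
move=> x; apply: continuous_comp; first exact: continuous_sqnorm.
exact: sqrt_continuous.
Qed.

Lemma continuous_conformal x : poincare_ball x -> {for x, continuous conformal}.
Proof.
move=> /sqnorm_lt1 x1.
have c (a : R) : {for x, continuous (fun=> a)} by exact: cst_continuous.
have d : {for x, continuous (fun y => 1 - sqnorm y)}.
  exact: (continuousB (c 1) (@continuous_sqnorm x)).
have d0 : 1 - sqnorm x != 0 by rewrite subr_eq0 gt_eqF.
exact: (continuousM (c 2) (@continuousV R _ (fun y => 1 - sqnorm y) x d0 d)).
Qed.

Lemma continuous_radius x :
  poincare_ball x -> {for x, continuous (@geodesic_radius R n)}.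
Proof.
move=> x1; apply: (continuous_comp (f := @enorm R n) (g := @hdist R)).
  exact: continuous_enorm.
have xN1 : -1 < enorm x by rewrite (lt_le_trans _ (enorm_ge0 x))// ltrN10.
have [dh _] := is_derive_hdist xN1 x1.
exact/differentiable_continuous/derivable1_diffP.
Qed.

Lemma radius_ge x : poincare_ball x -> 2 * enorm x <= geodesic_radius x.
Proof. by move=> x1; apply: hdist_ge => //; exact: enorm_ge0. Qed.

Lemma radius_le x : poincare_ball x ->
  geodesic_radius x <= 2 * conformal x * enorm x.
Proof.
move=> x1; apply: le_trans (hdist_le (enorm_ge0 x) x1) _.
by rewrite sqr_enorm /conformal le_eqVlt; apply/orP; left; apply/eqP; ring.
Qed.

Lemma radius_gt0 x : poincare_ball x -> x != 0 -> 0 < geodesic_radius x.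
Proof.
by move=> x1 x0; apply: lt_le_trans (radius_ge x1); rewrite mulr_gt0 ?enorm_gt0.
Qed.

Lemma geodesic_radius0 : geodesic_radius (0 : 'rV[R]_n) = 0.
Proof. by rewrite /geodesic_radius enorm0 addr0 subr0 divr1 ln1. Qed.

Lemma continuous_powR_at (a y : R) : 0 < y -> {for y, continuous (@powR R ^~ a)}.
Proof.
move=> y0; have [dh _] := is_derive1_powR a y0.
exact/differentiable_continuous/derivable1_diffP.
Qed.

(* A function bounded near the origin but possibly discontinuous there, such as
   [x_i / |x|]. *)
Definition admissible K Q :=
  (forall x, poincare_ball x -> x != 0 -> {for x, continuous Q}) /\
  exists M, forall x, K x -> `|Q x| <= M.

Lemma admissibleD K Q F : admissible K Q -> admissible K F ->
  admissible K (fun x => Q x + F x).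
Proof.
move=> [cQ [M QM]] [cF [N FN]]; split.
  by move=> x x1 x0; exact: (continuousD (cQ x x1 x0) (cF x x1 x0)).
exists (M + N) => x Kx; rewrite (le_trans (ler_normD _ _))// lerD//.
  exact: QM.
exact: FN.
Qed.

Lemma admissibleM K Q F : admissible K Q -> admissible K F ->
  admissible K (fun x => Q x * F x).
Proof.
move=> [cQ [M QM]] [cF [N FN]]; split.
  by move=> x x1 x0; exact: (continuousM (cQ x x1 x0) (cF x x1 x0)).
by exists (M * N) => x Kx; rewrite normrM ler_pM//; [exact: QM|exact: FN].
Qed.

Lemma admissible_cst K (a : R) : admissible K (fun=> a).
Proof. by split=> [x _ _|]; [exact: cst_continuous|exists `|a|]. Qed.

Lemma admissibleN K Q : admissible K Q -> admissible K (fun x => - Q x).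
Proof.
move=> [cQ [M QM]]; split; first by move=> x x1 x0; exact: (continuousN (cQ x x1 x0)).
by exists M => x Kx; rewrite normrN; exact: QM.
Qed.

Lemma admissibleX K Q k : admissible K Q -> admissible K (fun x => Q x ^+ k).
Proof.
move=> aQ; elim: k => [|k IH]; first exact: admissible_cst.
under eq_fun do rewrite exprS; exact: admissibleM.
Qed.

Lemma admissible_sum K (s : seq 'I_n) (Q : 'I_n -> 'rV[R]_n -> R) :
  (forall i, admissible K (Q i)) -> admissible K (fun x => \sum_(i <- s) Q i x).
Proof.
move=> aQ; elim: s => [|i s IH].
  rewrite (_ : (fun _ => _) = fun=> 0); first exact: admissible_cst.
  by apply/funext => x; rewrite big_nil.
rewrite (_ : (fun _ => _) = fun x => Q i x + \sum_(j <- s) Q j x).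
  exact: admissibleD.
by apply/funext => x; rewrite big_cons.
Qed.

Lemma admissible_continuous K Q : compact K -> K `<=` @poincare_ball R n ->
  (forall x, poincare_ball x -> {for x, continuous Q}) -> admissible K Q.
Proof.
move=> cK KB cQ; split=> [x x1 _|]; first exact: cQ.
have : compact (Q @` K).
  apply: continuous_compact => //; apply: continuous_in_subspaceT => x.
  by rewrite inE => /KB; exact: cQ.
move=> /compact_bounded[M [_ QM]]; exists (M + 1) => x Kx.
by apply: (QM (M + 1)); [rewrite ltrDl|exists x].
Qed.

Lemma admissible_conformal K : compact K -> K `<=` @poincare_ball R n ->
  admissible K conformal.
Proof.
by move=> cK KB; apply: admissible_continuous => // x; exact: continuous_conformal.
Qed.

Lemma admissible_radius K : compact K -> K `<=` @poincare_ball R n ->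
  admissible K (@geodesic_radius R n).
Proof.
by move=> cK KB; apply: admissible_continuous => // x; exact: continuous_radius.
Qed.

Lemma admissible_coord K i : compact K -> K `<=` @poincare_ball R n ->
  admissible K (fun x => x ord0 i).
Proof.
by move=> cK KB; apply: admissible_continuous => // x _; exact: coord_continuous.
Qed.

Lemma continuous_inv_enorm x : x != 0 ->
  {for x, continuous (fun y => (enorm y)^-1)}.
Proof.
move=> x0; apply: continuousV; last exact: continuous_enorm.
by rewrite gt_eqF// enorm_gt0.
Qed.

(** The ratio is at most [2 phi], which is bounded on [K]; at the origin it is 0 because
    [0^-1 = 0]. *)
Lemma admissible_radius_ratio K : compact K -> K `<=` @poincare_ball R n ->
  admissible K (fun x => geodesic_radius x / enorm x).
Proof.
move=> cK KB; split=> [x x1 x0|].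
  exact: (continuousM (continuous_radius x1) (continuous_inv_enorm x0)).
have [_ [M cM]] := admissible_conformal cK KB; exists (2 * M) => x Kx.
have [->|x0] := eqVneq x 0.
  rewrite enorm0 invr0 mulr0 normr0 mulr_ge0//.
  by apply: le_trans (cM x Kx).
have xB := KB x Kx.
rewrite ger0_norm; last by rewrite divr_ge0 ?enorm_ge0// ltW// radius_gt0.
rewrite ler_pdivrMr ?enorm_gt0// (le_trans (radius_le xB))//.
rewrite ler_wpM2r ?enorm_ge0// ler_wpM2l//.
by rewrite (le_trans _ (cM x Kx))// ler_norm.
Qed.

Lemma admissible_direction K i : admissible K (fun x => x ord0 i / enorm x).
Proof.
split=> [x x1 x0|].
  have ci := @coord_continuous R 1 n ord0 i x.
  exact: (continuousM ci (continuous_inv_enorm x0)).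
exists 1 => x _; have [->|x0] := eqVneq x 0.
  by rewrite enorm0 invr0 mulr0 normr0.
rewrite normrM normfV [`|enorm x|]ger0_norm ?enorm_ge0//.
by rewrite ler_pdivrMr ?enorm_gt0// mul1r le_coord_enorm.
Qed.

End weights.

(** * Integrability of admissible functions against a power of rho *)

Section weighted.
Context (R : realType) (n : nat).
Implicit Types (x : 'rV[R]_n) (Q F : 'rV[R]_n -> R) (K : set 'rV[R]_n).

(* Equal to [0], not [+oo], at the origin. *)
Definition radius_weight (a : R) x : R := geodesic_radius x `^ (- a).

Lemma radius_weight0 (a : R) : 0 < a -> radius_weight a 0 = 0.
Proof. by move=> a0; rewrite /radius_weight geodesic_radius0 powR0// oppr_eq0 gt_eqF. Qed.

Lemma radius_weight_ge0 a x : 0 <= radius_weight a x.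
Proof. exact: powR_ge0. Qed.

Lemma continuous_radius_weight a x : poincare_ball x -> x != 0 ->
  {for x, continuous (radius_weight a)}.
Proof.
move=> x1 x0; apply: (continuous_comp (f := @geodesic_radius R n)
  (g := fun y => y `^ (- a))); first exact: continuous_radius.
exact/continuous_powR_at/radius_gt0.
Qed.

(** [rho >= 2 |x|] in the Euclidean norm, which dominates the sup norm used for the dyadic cubes. *)
Lemma radius_weight_le (a : R) x : 0 < a -> poincare_ball x ->
  radius_weight a x <= `|x| `^ (- a).
Proof.
move=> a0 x1; have [->|x0] := eqVneq x 0.
  by rewrite radius_weight0// powR_ge0.
have nx0 : 0 < `|x| by rewrite normr_gt0.
have r0 := radius_gt0 x1 x0.
rewrite /radius_weight !powRN lef_pV2 ?posrE ?powR_gt0//.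
apply: ge0_ler_powR; rewrite ?nnegrE ?normr_ge0 ?(ltW r0) ?(ltW a0)//.
apply: le_trans (mx_norm_le_enorm x) (le_trans _ (radius_ge x1)).
by rewrite mulr_natl mulr2n lerDl enorm_ge0.
Qed.

Lemma near_notin_eq0 K F x : closed K -> (forall y, ~ K y -> F y = 0) -> ~ K x ->
  \forall y \near x, F y = 0.
Proof.
move=> cK F0 Kx; have : nbhs x (~` K).
  by apply: open_nbhs_nbhs; split => //; exact: closed_openC.
by apply: filterS => y; exact: F0.
Qed.

(** On [K] both factors are continuous; off the closed set [K] the product is locally zero, whatever
    the weight does outside the ball. *)
Lemma continuous_weighted (a : R) K Q x : closed K -> K `<=` @poincare_ball R n ->
  admissible K Q -> (forall y, ~ K y -> Q y = 0) -> x != 0 ->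
  {for x, continuous (fun y => radius_weight a y * Q y)}.
Proof.
move=> cK KB [cQ _] Q0 x0; have [Kx|Kx] := pselect (K x).
  have x1 := KB x Kx.
  have cw := @continuous_radius_weight a x x1 x0.
  by have := @continuousM R _ _ _ x cw (cQ x x1 x0).
apply: (near_cst_continuous 0); apply: near_notin_eq0 Kx => //.
by move=> y /Q0 ->; rewrite mulr0.
Qed.

(** [Q] is bounded on [K], so the product is dominated by a multiple of [|x|^(-a)], and it vanishes
    for [|x| > 1] because [K] lies in the ball. *)
Lemma integrable_weighted (a : R) K Q : 0 < a -> a < n%:R ->
  closed K -> K `<=` @poincare_ball R n ->
  admissible K Q -> (forall y, ~ K y -> Q y = 0) ->
  (lebesgue_rV R n).-integrable setT
    (fun x => (radius_weight a x * Q x)%:E).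
Proof.
move=> a0 an cK KB aQ Q0.
have [_ [M QM]] := aQ.
have M0 : 0 <= Num.max M 0 by rewrite le_max lexx orbT.
apply: (@integrable_dominated_powR R n a (Num.max M 0)) => //.
- apply: continuous_off0_measurable => x x0.
  exact: (continuous_weighted cK KB aQ Q0 x0).
- move=> x _; have [Kx|/Q0 ->] := pselect (K x); last first.
    by rewrite mulr0 normr0 mulr_ge0// powR_ge0.
  rewrite normrM mulrC ler_pM// ?normr_ge0//.
    by rewrite (le_trans (QM x Kx))// le_max lexx.
  by rewrite ger0_norm ?radius_weight_ge0// radius_weight_le//; exact: KB.
move=> x x1; rewrite Q0 ?mulr0// => /KB.
by rewrite /poincare_ball/= ltNge (le_trans (ltW x1))// mx_norm_le_enorm.
Qed.

End weighted.

(** * The divergence of the boundary field *)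

Section line.
Context (R : realType).

Lemma is_derive_line n (F : 'rV[R]_n -> R) (x v : 'rV[R]_n) (t : R) :
  derivable F (x + t *: v) v ->
  is_derive t 1 (fun u : R => F (x + u *: v)) ('D_v F (x + t *: v)).
Proof.
move=> dF.
have E : (fun h : R => h^-1 *: (F (x + (h *: (1 : R) + t) *: v) - F (x + t *: v))) =
         (fun h => h^-1 *: (F (h *: v + (x + t *: v)) - F (x + t *: v))).
  apply/funext => h; congr (_ *: (F _ - _)).
  by rewrite scalerDl [h *: 1]mulr1 addrCA.
split; first by rewrite /derivable E.
by rewrite /derive E.
Qed.

Lemma sqnorm_line n (x : 'rV[R]_n) i t : x ord0 i = 0 ->
  sqnorm (x + t *: delta_mx ord0 i) = sqnorm x + t ^+ 2.
Proof.
move=> xi; rewrite /sqnorm (bigD1 i)//= [in RHS](bigD1 i)//= !mxE xi !eqxx/=.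
rewrite mulr1 add0r expr0n/= add0r addrC; congr (_ + _).
by apply: eq_bigr => j /negPf ji; rewrite !mxE eqxx ji/= mulr0 addr0.
Qed.

(* The derivative in direction [e_i] of the [i]-th component of
     - rho^(-s-2) phi^k (rho^2 f grad f + c phi (rho/|x|) f^2 x),
   divided by [rho^(-s-2)]. Here [k = n - 2], [f1] and [f2] are the first two
   derivatives of [f] in direction [e_i], [xi = x_i], [kap = rho/|x|] and
   [e = x_i/|x|]. *)
Definition field_div k (s c f f1 f2 xi phi rho kap e : R) : R :=
  - (f1 ^+ 2 + f * f2) * phi ^+ k * rho ^+ 2
  - f * f1 * xi * phi ^+ k.+1 * (k%:R * rho ^+ 2 - s * kap)
  - c * phi ^+ k.+1 * (2 * f * f1 * xi * kap + f ^+ 2 * kap +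
      f ^+ 2 * ((k%:R + 1) * phi * xi ^+ 2 * kap - (s + 1) * e ^+ 2 * phi
                - e ^+ 2 * kap)).

(** The functions stand for [|x|], [phi], [rho], [rho^(-s-2)], [f] and its partial derivative along
    a line in direction [e_i]. Abstracting them reduces the computation to the product rule and a
    [field] identity. *)
Lemma is_derive_field k (s c t f2 : R) (r phi rho P f f1 : R -> R) :
  r t != 0 -> rho t != 0 ->
  is_derive t 1 r (t / r t) ->
  is_derive t 1 phi (phi t ^+ 2 * t) ->
  is_derive t 1 rho (phi t * t / r t) ->
  is_derive t 1 P (- (s + 2) * P t * (phi t * t / r t) / rho t) ->
  is_derive t 1 f (f1 t) -> is_derive t 1 f1 f2 ->
  is_derive t 1
    (fun u => - (P u * phi u ^+ k.+1 * (f u * f1 u * rho u ^+ 2 +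
       c * (f u ^+ 2 * u * phi u * rho u * (r u)^-1))))
    (P t * field_div k.+1 s c (f t) (f1 t) f2 t (phi t) (rho t)
       (rho t / r t) (t / r t)).
Proof.
move=> r0 rho0 dr dphi drho dP df df1.
have drV := is_deriveV r0 dr.
pose rV : R -> R := fun y => (r y)^-1.
have {}drV : is_derive t 1 rV _ := drV.
(* Written as an algebraic combination of functions, the field can be differentiated by the
   [is_derive] instances. *)
pose V : R -> R := - (P * phi ^+ k.+1 * (f * f1 * rho ^+ 2 +
  cst c * (f ^+ 2 * id * phi * rho * rV))).
rewrite (_ : (fun u : R => _) = V); last first.
  by apply/funext => u; rewrite /V !fctE.
rewrite /V; apply: is_derive_eq.
rewrite /field_div /GRing.scale/= !fctE /rV !exprS.
set z := phi t ^+ k; field.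
by rewrite r0 rho0.
Qed.

(** Here [b] is the squared distance from the origin to a line in direction [e_i], so
    [|x|^2 = b + t^2] on it; [b > 0] keeps the square root away from its singularity. *)
Lemma is_derive_radius_line (b t : R) : 0 < b ->
  is_derive t 1 (fun u => Num.sqrt (b + u ^+ 2)) (t / Num.sqrt (b + t ^+ 2)).
Proof.
move=> b0; have q0 : 0 < b + t ^+ 2 by rewrite ltr_wpDr// sqr_ge0.
have dq : is_derive t 1 (cst b + id ^+ 2 : R -> R) (2 * t).
  by apply: is_derive_eq; rewrite /GRing.scale/=; ring.
have ds := @is_derive1_comp R (@Num.sqrt R) _ t _ _ (is_derive1_sqrt q0) dq.
apply: (is_derive_eq ds); field.
by rewrite gt_eqF// sqrtr_gt0.
Qed.

Lemma is_derive_conformal_line (b t : R) : b + t ^+ 2 < 1 ->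
  is_derive t 1 (fun u => 2 / (1 - (b + u ^+ 2)))
    ((2 / (1 - (b + t ^+ 2))) ^+ 2 * t).
Proof.
move=> q1; have q0 : 1 - (b + t ^+ 2) != 0 by rewrite subr_eq0 gt_eqF.
have dq : is_derive t 1 (fun u : R => 1 - (b + u ^+ 2)) (- (2 * t)).
  rewrite (_ : (fun u : R => _) = cst (1 - b) - id ^+ 2); last first.
    by apply/funext => u; rewrite !fctE opprD addrA.
  by apply: is_derive_eq; rewrite /GRing.scale/=; ring.
have dV := @is_deriveV R (fun u : R => 1 - (b + u ^+ 2)) t _ 1 q0 dq.
have D := is_deriveM (is_derive_cst (2 : R) t 1) dV.
apply: (is_derive_eq D).
by rewrite /GRing.scale/=; field.
Qed.

Lemma is_derive_hdist_line (b t : R) : 0 < b -> b + t ^+ 2 < 1 ->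
  is_derive t 1 (fun u => hdist (Num.sqrt (b + u ^+ 2)))
    (2 / (1 - (b + t ^+ 2)) * t / Num.sqrt (b + t ^+ 2)).
Proof.
move=> b0 q1; have q0 : 0 < b + t ^+ 2 by rewrite ltr_wpDr// sqr_ge0.
have s1 : Num.sqrt (b + t ^+ 2) < 1 by rewrite -[ltRHS]sqrtr1 ltr_sqrt.
have s2 : -1 < Num.sqrt (b + t ^+ 2).
  by rewrite (lt_le_trans _ (sqrtr_ge0 _))// ltrN10.
have dh := @is_derive1_comp R (@hdist R) _ t _ _ (is_derive_hdist s2 s1)
  (is_derive_radius_line t b0).
apply: (is_derive_eq dh).
by rewrite sqr_sqrtr ?(ltW q0)// mulrA.
Qed.

Lemma is_derive_powR_hdist_line (a b t : R) : 0 < b -> b + t ^+ 2 < 1 ->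
  let r := Num.sqrt (b + t ^+ 2) in
  is_derive t 1 (fun u => hdist (Num.sqrt (b + u ^+ 2)) `^ (- a))
    (- a * hdist r `^ (- a) * (2 / (1 - (b + t ^+ 2)) * t / r) / hdist r).
Proof.
move=> b0 q1 r; have q0 : 0 < b + t ^+ 2 by rewrite ltr_wpDr// sqr_ge0.
have s0 : 0 < r by rewrite sqrtr_gt0.
have s1 : r < 1 by rewrite -[ltRHS]sqrtr1 ltr_sqrt.
have h0 : 0 < hdist r.
  by rewrite (lt_le_trans _ (hdist_ge (ltW s0) s1))// mulr_gt0.
have dp := @is_derive1_comp R (@powR R ^~ (- a))
  (fun u => hdist (Num.sqrt (b + u ^+ 2))) t _ _
  (is_derive1_powR (- a) h0) (is_derive_hdist_line b0 q1).
apply: (is_derive_eq dp); rewrite -/r.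
rewrite powRB ?powRr1 ?(ltW h0)//; last by rewrite (gt_eqF h0) implybT.
by ring.
Qed.

End line.

Section divergence.
Context (R : realType) (n : nat).
Implicit Types (x : 'rV[R]_n) (F : 'rV[R]_n -> R) (K : set 'rV[R]_n).

Lemma partial_notin_eq0 K F i : closed K -> (forall x, ~ K x -> F x = 0) ->
  forall x, ~ K x -> partial i F x = 0.
Proof.
move=> cK F0 x Kx.
rewrite /partial (@near_eq_derive _ _ _ F (cst 0) x) ?derive_cst//.
exact: near_notin_eq0 Kx.
Qed.

Lemma sqnorm_gt0 x j : x ord0 j != 0 -> 0 < sqnorm x.
Proof.
move=> xj; rewrite /sqnorm (bigD1 j)//= ltr_wpDr//.
  by apply: sumr_ge0 => i _; exact: sqr_ge0.
by rewrite exprn_even_gt0.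
Qed.

Context (f : 'rV[R]_n -> R) (tf : test_function f).
Let K := tsupport f.

Lemma closed_tsupport : closed K. Proof. exact: closed_closure. Qed.

Lemma tsupport_ball : K `<=` @poincare_ball R n. Proof. by have [] := tf. Qed.

Lemma notin_tsupport x : ~ K x -> f x = 0.
Proof.
by move=> Kx; apply/eqP/negP => /negP fx; apply: Kx; exact: subset_closure.
Qed.

Lemma partial_notin i x : ~ K x -> partial i f x = 0.
Proof. exact: (partial_notin_eq0 i closed_tsupport notin_tsupport). Qed.

Lemma partial2_notin i j x : ~ K x -> partial i (partial j f) x = 0.
Proof.
exact: (partial_notin_eq0 i closed_tsupport (fun x => @partial_notin j x)).
Qed.

Let ctsK F : continuous F -> admissible K F.
Proof.
move=> cF; have [_ cK _] := tf.
by apply: admissible_continuous => // [|x _]; [exact: tsupport_ball|exact: cF].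
Qed.

Lemma admissible_test : admissible K f.
Proof. by apply: ctsK; have [/(_ [::])[]] := tf. Qed.

Lemma admissible_partial i : admissible K (partial i f).
Proof. by apply: ctsK; have [/(_ [:: i])[]] := tf. Qed.

Lemma admissible_partial2 i j : admissible K (partial i (partial j f)).
Proof. by apply: ctsK; have [/(_ [:: i; j])[]] := tf. Qed.

Context (k : nat) (s c : R).

Definition div_density i x : R :=
  field_div k s c (f x) (partial i f x) (partial i (partial i f) x) (x ord0 i)
    (conformal x) (geodesic_radius x) (geodesic_radius x / enorm x)
    (x ord0 i / enorm x).

Lemma div_density_notin i x : ~ K x -> div_density i x = 0.
Proof.
move=> Kx; rewrite /div_density notin_tsupport// partial_notin//.
by rewrite /field_div !expr2; ring.
Qed.

(** In [field_div] the only divisions by [|x|] are those in [kap = rho/|x|] and [e = x_i/|x|], both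
    bounded on [K]. *)
Lemma admissible_div_density i : admissible K (div_density i).
Proof.
have [_ cK KB] := tf.
have aC := admissible_conformal cK KB; have aR := admissible_radius cK KB.
have aQ := admissible_radius_ratio cK KB.
have aX := admissible_coord i cK KB; have aE := @admissible_direction R n K i.
have af := admissible_test; have a1 := admissible_partial i.
have a2 := admissible_partial2 i i.
have cst a := @admissible_cst R n K a.
have D := @admissibleD R n K; have M := @admissibleM R n K.
have N := @admissibleN R n K; have X := fun m F => @admissibleX R n K F m.
apply: (D); first apply: (D).
- apply: (M _ _ _ (X _ _ aR)); apply: (M _ _ _ (X _ _ aC)); apply: (N).
  by apply: (D); [exact: X|exact: (M)].
- apply: (N); apply: (M).
    by apply: (M _ _ _ (X _ _ aC)); apply: (M _ _ _ aX); exact: (M).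
  apply: (D); first by apply: (M); [exact: cst|exact: (X)].
  by apply: (N); apply: (M _ _ _ aQ); exact: cst.
- apply: (N); apply: (M); first by apply: (M _ _ _ (X _ _ aC)); exact: cst.
  apply: (D); first apply: (D).
  + apply: (M _ _ _ aQ); apply: (M _ _ _ aX); apply: (M _ _ _ a1).
    by apply: (M _ _ _ af); exact: cst.
  + by apply: (M _ _ _ aQ); exact: (X).
  + apply: (M); first exact: (X).
    apply: (D); first apply: (D).
    * apply: (M _ _ _ aQ); apply: (M _ _ _ (X _ _ aX)).
      by apply: (M _ _ _ aC); exact: cst.
    * by apply: (N); apply: (M _ _ _ aC); apply: (M _ _ _ (X _ _ aE)); exact: cst.
    * by apply: (N); apply: (M _ _ _ aQ); exact: (X).
Qed.

End divergence.

Section divergence_theorem.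
Context (R : realType) (n : nat) (f : 'rV[R]_n -> R) (tf : test_function f).
Context (k : nat) (s c : R).
Context (n_gt1 : (1 < n)%N) (s_gt0 : 0 < s + 2) (s_lt : s + 2 < n%:R).
Let K := tsupport f.

Lemma integrable_div_density i : (lebesgue_rV R n).-integrable setT
  (fun x => (radius_weight (s + 2) x * div_density f k.+1 s c i x)%:E).
Proof.
apply: (@integrable_weighted R n (s + 2) K) => //.
- exact: closed_tsupport.
- exact: tsupport_ball.
- exact: admissible_div_density.
- by move=> x; exact: div_density_notin.
Qed.

Let line (x : 'rV[R]_n) (i : 'I_n) (t : R) : 'rV[R]_n := x + t *: delta_mx ord0 i.

Let continuous_line x i : continuous (line x i).
Proof.
move=> t; have c0 : {for t, continuous (fun _ : R => x)}.
  exact: cst_continuous.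
have c1 : {for t, continuous (fun u : R => u *: delta_mx ord0 i : 'rV[R]_n)}.
  exact: scalel_continuous.
exact: (continuousD c0 c1).
Qed.

(** The integrand is the continuous derivative of the [i]-th component of the field along the line,
    and this component vanishes outside the ball. *)
Lemma integral_div_line (x : 'rV[R]_n) i : x ord0 i = 0 ->
  (forall j, j != i -> x ord0 j != 0) ->
  (\int[lebesgue_measure]_t (radius_weight (s + 2) (line x i t) *
     div_density f k.+1 s c i (line x i t))%:E)%E = 0%E.
Proof.
move=> xi xN0.
(* As [n > 1], some index [j] differs from [i], and [x_j != 0] makes the line miss the origin. *)
have b0 : 0 < sqnorm x.
  have i0 : (0 < n)%N := ltnW n_gt1.
  pose j : 'I_n := if i == Ordinal i0 then Ordinal n_gt1 else Ordinal i0.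
  apply: (@sqnorm_gt0 _ _ _ j); apply: xN0; rewrite /j.
  by have [->|] := eqVneq i (Ordinal i0); [rewrite -val_eqE|rewrite eq_sym].
set b := sqnorm x in b0.
have sqE t : sqnorm (line x i t) = b + t ^+ 2 by exact: sqnorm_line.
have line0 t : line x i t != 0.
  apply/eqP => l0; have := sqE t; rewrite l0 /sqnorm big1 => [|j _].
    by apply/eqP; rewrite lt_eqF// ltr_wpDr// sqr_ge0.
  by rewrite mxE expr0n.
have ciE t : line x i t ord0 i = t by rewrite !mxE xi !eqxx mulr1 add0r.
pose F t := f (line x i t); pose F1 t := partial i f (line x i t).
pose r t := Num.sqrt (b + t ^+ 2).
pose phi t := 2 / (1 - (b + t ^+ 2)).
pose rho t := hdist (r t).
pose P t := rho t `^ (- (s + 2)).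
pose V t := - (P t * phi t ^+ k.+1 * (F t * F1 t * rho t ^+ 2 +
       c * (F t ^+ 2 * t * phi t * rho t * (r t)^-1))).
pose g t := radius_weight (s + 2) (line x i t) *
     div_density f k.+1 s c i (line x i t).
have [smf _ KB] := tf.
have dV (t : R) : is_derive t 1 V (g t).
  (* Off the support the line may leave the ball, where the formulas for [rho] and [phi] break down,
     but [V] is locally zero there. *)
  have [Kt|Kt] := pselect (K (line x i t)); last first.
    rewrite /g div_density_notin// mulr0.
    apply: near_eq_is_derive (is_derive_cst (0 : R) t 1).
    have : \forall u \near t, ~ K (line x i u).
      apply: (@continuous_line x i t (~` K)).
      apply: open_nbhs_nbhs; split => //.
      by apply: closed_openC; exact: closed_tsupport.
    apply: filterS => u Ku; rewrite /V /F /F1 (notin_tsupport Ku).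
    by rewrite (partial_notin _ Ku) expr0n/= !mul0r mulr0 addr0 mulr0 oppr0.
  have q1 : b + t ^+ 2 < 1 by rewrite -sqE; exact/sqnorm_lt1/KB.
  have rE : enorm (line x i t) = r t by rewrite /enorm sqE.
  have rhoE : geodesic_radius (line x i t) = rho t.
    by rewrite /geodesic_radius rE.
  have phiE : conformal (line x i t) = phi t by rewrite /conformal sqE.
  have PE : radius_weight (s + 2) (line x i t) = P t.
    by rewrite /radius_weight rhoE.
  have rt0 : r t != 0.
    by have := enorm_gt0 (line0 t); rewrite rE; exact: lt0r_neq0.
  have rhot0 : rho t != 0.
    have := radius_gt0 (KB _ Kt) (line0 t); rewrite rhoE; exact: lt0r_neq0.
  rewrite /g PE /div_density rE rhoE phiE ciE.
  apply: (@is_derive_field R k s c t (partial i (partial i f) (line x i t))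
    r phi rho P F F1).
  - exact: rt0.
  - exact: rhot0.
  - exact: is_derive_radius_line.
  - exact: is_derive_conformal_line.
  - exact: is_derive_hdist_line.
  - exact: is_derive_powR_hdist_line.
  - by apply: is_derive_line; have [_] := smf [::]; exact.
  - by apply: is_derive_line; have [_] := smf [:: i]; exact.
have cg : continuous g.
  move=> t; apply: (continuous_comp (f := line x i)
    (g := fun y => radius_weight (s + 2) y * div_density f k.+1 s c i y)).
    exact: continuous_line.
  apply: (@continuous_weighted _ _ _ K) => //.
  - exact: closed_tsupport.
  - exact: admissible_div_density.
  - by move=> y; exact: div_density_notin.
have out (t : R) : 1 <= `|t| -> ~ K (line x i t).
  move=> t1 /KB /sqnorm_lt1; rewrite sqE ltNge => /negP; apply.
  rewrite -real_normK ?num_real// -[leLHS]add0r lerD ?(ltW b0)//.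
  by rewrite exprn_ege1.
have V0 (t : R) : 1 <= `|t| -> V t = 0.
  move=> /out Kt; rewrite /V /F (notin_tsupport Kt).
  by rewrite expr0n/= !mul0r mulr0 addr0 mulr0 oppr0.
(* The integrand vanishes for [|t| >= 1], hence outside this interval, and [V] is zero at both
   ends. *)
rewrite [LHS](_ : _ = \int[lebesgue_measure]_(t in `[(-2)%R, 2%R]) (g t)%:E)%E.
  rewrite (@continuous_FTC2 R g V)//.
  - by rewrite !V0 ?normrN ?ger0_norm ?ler1n// subee.
  - by rewrite -subr_gt0 opprK addr_gt0.
  - exact: continuous_subspaceT.
  - have cV (t : R) : {for t, continuous V}.
      have [dh _] := dV t; exact/differentiable_continuous/derivable1_diffP.
    split.
    + by move=> t _; have [] := dV t.
    + by apply: cvg_at_right_filter; exact: cV.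
    + by apply: cvg_at_left_filter; exact: cV.
  - by move=> t _; rewrite derive1E; have [_ ->] := dV t.
rewrite [RHS]integral_mkcond; apply: eq_integral => t _; rewrite patchE.
case: ifPn => // /negP tN; rewrite div_density_notin ?mulr0//.
apply: out; rewrite leNgt; apply/negP => t1; apply: tN.
by rewrite inE/= in_itv/= -ler_norml (le_trans (ltW t1))// ler1n.
Qed.

Lemma integral_div_density i : (\int[lebesgue_rV R n]_x
  (radius_weight (s + 2) x * div_density f k.+1 s c i x)%:E)%E = 0%E.
Proof.
apply: (integral_lines_eq0 (integrable_div_density i)) => x xi xN0.
exact: integral_div_line.
Qed.

End divergence_theorem.

(** * The pointwise inequality *)

Section pointwise.
Context (R : realType).

(** [field_div] is affine in [f1^2], [f2], [x f1], [x^2] and [e^2], so only the sums of these over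
    [i] enter the divergence. *)
Lemma sum_field_div n k (s c f phi rho kap : R) (f1 f2 x e : 'I_n -> R) :
  \sum_i field_div k s c f (f1 i) (f2 i) (x i) phi rho kap (e i) =
  - (\sum_i f1 i ^+ 2 + f * \sum_i f2 i) * phi ^+ k * rho ^+ 2
  - f * (\sum_i x i * f1 i) * phi ^+ k.+1 * (k%:R * rho ^+ 2 - s * kap)
  - c * phi ^+ k.+1 * (2 * f * (\sum_i x i * f1 i) * kap + n%:R * f ^+ 2 * kap +
      f ^+ 2 * ((k%:R + 1) * phi * (\sum_i x i ^+ 2) * kap
        - (s + 1) * (\sum_i e i ^+ 2) * phi - (\sum_i e i ^+ 2) * kap)).
Proof.
set u := phi ^+ k; set v := phi ^+ k.+1.
rewrite (eq_bigr (fun i =>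
  (- u * rho ^+ 2) * f1 i ^+ 2 + (- f * u * rho ^+ 2) * f2 i
  + (- f * v * (k%:R * rho ^+ 2 - s * kap) - c * v * 2 * f * kap) * (x i * f1 i)
  + (- c * v * f ^+ 2 * kap)
  + (- c * v * f ^+ 2 * (k%:R + 1) * phi * kap) * x i ^+ 2
  + (c * v * f ^+ 2 * ((s + 1) * phi + kap)) * e i ^+ 2)); last first.
  by move=> i _; rewrite /field_div -/u -/v; ring.
rewrite !big_split/= -!mulr_sumr sumr_const card_ord -[_ *+ n]mulr_natr.
by ring.
Qed.

(** This is [|grad f + h x|^2] expanded, the square completed in Hardy's inequality. *)
Lemma sum_sqr_ge0 n (f1 x : 'I_n -> R) h :
  0 <= \sum_i f1 i ^+ 2 + 2 * h * (\sum_i x i * f1 i) + h ^+ 2 * \sum_i x i ^+ 2.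
Proof.
have : 0 <= \sum_i (f1 i + h * x i) ^+ 2 by apply: sumr_ge0 => i _; exact: sqr_ge0.
rewrite (eq_bigr (fun i => f1 i ^+ 2 + 2 * h * (x i * f1 i) + h ^+ 2 * x i ^+ 2)).
  by rewrite !big_split/= -!mulr_sumr.
by move=> i _; ring.
Qed.

(* With [L] the Laplacian and [T = rho coth rho - 1], the difference of the two
   sides is
     u phi^2 (L rho^2 + A f)^2 + 2 A u rho^2 (S1 + 2 h E + h^2 r^2)
     + A (m + 1) m f^2 (u phi^2 T - rho^2). *)
Lemma rellich_density (m s A f S1 lap E u phi rho r h kap : R) :
  0 <= m -> A = (m - s) * (m + s) / 4 -> 0 <= A -> 4 <= u ->
  0 < r -> r < 1 -> phi = 2 / (1 - r ^+ 2) ->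
  2 * r <= rho -> rho <= 2 * phi * r ->
  kap = rho / r -> h = f * ((m - s) / 2) * phi / (rho * r) ->
  0 <= S1 + 2 * h * E + h ^+ 2 * r ^+ 2 ->
  A ^+ 2 * (f ^+ 2 * (u * phi ^+ 2)) + A * (m + 1) * m * (f ^+ 2 * rho ^+ 2) +
  2 * A * (- (S1 + f * lap) * u * rho ^+ 2
    - f * E * (phi * u) * (m * rho ^+ 2 - s * kap)
    - m / 2 * (phi * u) * (2 * f * E * kap + (m + 2) * f ^+ 2 * kap +
      f ^+ 2 * ((m + 1) * phi * r ^+ 2 * kap - (s + 1) * 1 * phi - 1 * kap)))
  <= ((1 - r ^+ 2) ^+ 2 / 4 * lap + m * ((1 - r ^+ 2) / 2) * E) ^+ 2 * rho ^+ 4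
     * (u * phi ^+ 2).
Proof.
move=> m0 AE A0 u4 r0 r1 phiE rho1 rho2 kapE hE H0.
set L := _ * lap + _.
have q1 : 1 - r ^+ 2 != 0 by rewrite subr_eq0 gt_eqF// expr_lt1// ltW.
have rho0 : 0 < rho by rewrite (lt_le_trans _ rho1)// mulr_gt0.
have u0 : 0 <= u by rewrite (le_trans _ u4).
(* Since [r = tanh (rho / 2)], one has [coth rho = (1 + r^2) / (2 r)]. *)
pose T := kap * (1 + r ^+ 2) / 2 - 1.
rewrite -subr_ge0 [X in 0 <= X](_ : _ =
  u * phi ^+ 2 * (L * rho ^+ 2 + A * f) ^+ 2 +
  2 * A * u * rho ^+ 2 * (S1 + 2 * h * E + h ^+ 2 * r ^+ 2) +
  A * (m + 1) * m * f ^+ 2 * (u * phi ^+ 2 * T - rho ^+ 2)); last first.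
  rewrite AE /L hE /T kapE phiE; field.
  by rewrite q1 !gt_eqF.
(* [rho >= 2 r] means [kap >= 2], so [T >= (1 + r^2) - 1]. *)
have T0 : r ^+ 2 <= T.
  rewrite /T lerBrDr ler_pdivlMr//.
  have k2 : 2 <= kap by rewrite kapE ler_pdivlMr.
  have := sqr_ge0 r; nra.
(* This combines [rho <= 2 phi r], [u >= 4] and [T >= r^2]. *)
have rho_sq : rho ^+ 2 <= u * phi ^+ 2 * T.
  apply: (@le_trans _ _ (4 * phi ^+ 2 * r ^+ 2)).
    have -> : 4 * phi ^+ 2 * r ^+ 2 = (2 * phi * r) ^+ 2 by ring.
    by rewrite ler_pXn2r// nnegrE ?(ltW rho0)// (le_trans (ltW rho0)).
  apply: ler_pM => //; [|exact: sqr_ge0|].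
    by rewrite mulr_ge0 ?sqr_ge0.
  by apply: ler_wpM2r => //; exact: sqr_ge0.
apply: addr_ge0; first apply: addr_ge0.
- by apply: mulr_ge0; [apply: mulr_ge0 => //|]; exact: sqr_ge0.
- by apply: mulr_ge0 => //; apply: mulr_ge0; [apply: mulr_ge0 => //|exact: sqr_ge0];
    apply: mulr_ge0.
- apply: mulr_ge0; last by rewrite subr_ge0.
  apply: mulr_ge0; last exact: sqr_ge0.
  by apply: mulr_ge0 => //; apply: mulr_ge0 => //; exact: addr_ge0.
Qed.

End pointwise.

Section rellich_density_ball.
Context (R : realType).

Lemma sum_direction_sqr n (x : 'rV[R]_n) : x != 0 ->
  \sum_i (x ord0 i / enorm x) ^+ 2 = 1.
Proof.
move=> x0; under eq_bigr do rewrite expr_div_n.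
rewrite -mulr_suml -[X in X / _]/(sqnorm x) -sqr_enorm divff//.
by rewrite expf_neq0// lt0r_neq0// enorm_gt0.
Qed.

Context (k : nat) (beta : R).
Local Notation n := (k.+3).
Local Notation m := (k.+1%:R : R).
Local Notation s := (beta + 2).
Local Notation A := ((n%:R + beta) * (n%:R - 4 - beta) / 4 : R).

Let nE : n%:R = m + 2 :> R.
Proof. by rewrite -natrD addn2. Qed.

(** The integrand of the left-hand side with the common weight [rho^(-beta-4)] divided out. *)
Definition laplacian_density (f : 'rV[R]_n -> R) x :=
  laplace_beltrami f x ^+ 2 * geodesic_radius x ^+ 4 * conformal x ^+ n.

(** The theorem before integration, up to a divergence. The coefficient [c = m / 2] of the field
    maximises [c (m - s) - (c - s / 2)^2], the constant left after completing the square; the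
    maximum is [A]. *)
Lemma laplacian_density_ge (f : 'rV[R]_n -> R) x : (0 < k)%N -> 0 <= A ->
  poincare_ball x -> x != 0 ->
  A ^+ 2 * (f x ^+ 2 * conformal x ^+ n) +
  A * (m + 1) * m * (f x ^+ 2 * geodesic_radius x ^+ 2) +
  2 * A * \sum_i div_density f k.+1 s (m / 2) i x <= laplacian_density f x.
Proof.
have AE : A = (m - s) * (m + s) / 4 by rewrite nE; field.
move: (A) AE => a aE k0 a0 xB x0; rewrite /laplacian_density /div_density sum_field_div.
rewrite sum_direction_sqr// -/(sqnorm x) -sqr_enorm -/(laplacian f x).
rewrite /laplace_beltrami nE addrK -sqr_enorm.
have -> : conformal x ^+ n = conformal x ^+ k.+1 * conformal x ^+ 2.
  by rewrite -exprD addn2.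
rewrite [conformal x ^+ k.+2]exprS.
have c2 := conformal_ge2 xB.
have r0 := enorm_gt0 x0.
set S1 := \sum_(i < _) partial i f x ^+ 2.
set E := \sum_(i < _) x ord0 i * partial i f x.
pose h := f x * ((m - s) / 2) * conformal x / (geodesic_radius x * enorm x).
apply: (@rellich_density _ m s a (f x) S1 _ E _ _ _ (enorm x) h) => //.
(* Here [u = phi^(n-2) >= 2^(n-2) >= 4], because [phi >= 2] and [n >= 4]. *)
- have -> : 4 = 2 ^+ 2 :> R by rewrite expr2 -natrM.
  apply: (@le_trans _ _ (2 ^+ k.+1)).
    by rewrite ler_weXn2l// ler1n.
  by apply: lerXn2r => //; rewrite nnegrE// (le_trans _ c2).
- by rewrite sqr_enorm.
- exact: radius_ge.
- exact: radius_le.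
- by have := sum_sqr_ge0 (fun i => partial i f x) (fun i => x ord0 i) h;
    rewrite -/(sqnorm x) sqr_enorm.
Qed.

End rellich_density_ball.

(** * Integration of the pointwise inequality *)

Section assembly.
Context (R : realType) (n : nat) (f : 'rV[R]_n -> R) (tf : test_function f).
Let K := tsupport f.

Lemma integral_ball (F : 'rV[R]_n -> R) : (forall x, ~ K x -> F x = 0) ->
  integral_dx F = (\int[lebesgue_rV R n]_x (F x)%:E)%E.
Proof.
move=> F0; rewrite /integral_dx integral_mkcond; apply: eq_integral => x _.
rewrite patchE; case: ifPn => // /negP xB; rewrite F0// => Kx.
by apply: xB; rewrite inE; exact: (tsupport_ball tf Kx).
Qed.

Lemma laplace_beltrami_notin x : ~ K x -> laplace_beltrami f x = 0.
Proof.
move=> Kx; rewrite /laplace_beltrami /laplacian !big1 ?mulr0 ?addr0// => i _.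
  by rewrite partial_notin ?mulr0.
exact: partial2_notin.
Qed.

Lemma admissible_laplace_beltrami : admissible K (laplace_beltrami f).
Proof.
have [_ cK KB] := tf.
have D := @admissibleD R n K; have M := @admissibleM R n K.
have C a := @admissible_cst R n K a.
have aS : admissible K (fun x => 1 - sqnorm x).
  apply: admissible_continuous => // x _.
  have c1 : {for x, continuous (fun=> 1 : R)} by exact: cst_continuous.
  exact: (continuousB c1 (@continuous_sqnorm R n x)).
apply: (D).
  apply: (M _ _ (M _ _ (admissibleX 2 aS) (C _))).
  by apply: admissible_sum => i; exact: admissible_partial2.
apply: (M _ _ (M _ _ (C _) (M _ _ aS (C _)))).
apply: admissible_sum => i; apply: (M _ _ (admissible_coord i cK KB)).
exact: admissible_partial.
Qed.

(** The exponent is split as [-beta = -(beta + 4) + 4], which is legitimate because [rho > 0]. *)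
Lemma laplacian_weight_eq (beta : R) (x : 'rV[R]_n) : poincare_ball x -> x != 0 ->
  `|laplace_beltrami f x| ^+ 2 / geodesic_radius x `^ beta * conformal x ^+ n =
  radius_weight (beta + 2 + 2) x *
  (laplace_beltrami f x ^+ 2 * geodesic_radius x ^+ 4 * conformal x ^+ n).
Proof.
move=> xB x0; have r0 := radius_gt0 xB x0.
have -> : (geodesic_radius x `^ beta)^-1 =
    radius_weight (beta + 2 + 2) x * geodesic_radius x ^+ 4.
  rewrite /radius_weight -powR_mulrn ?(ltW r0)// -powRN -powRD.
    by congr (_ `^ _); ring.
  by rewrite (gt_eqF r0) implybT.
by rewrite real_normK ?num_real//; ring.
Qed.

(** The origin is included: there [beta + 2 > 0] makes the left side [0^-1 = 0], and the factor
    [rho^2] makes the right side 0. *)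
Lemma radius_power_eq (beta : R) (x : 'rV[R]_n) : 0 < beta + 2 -> poincare_ball x ->
  (geodesic_radius x `^ (beta + 2))^-1 =
  radius_weight (beta + 2 + 2) x * geodesic_radius x ^+ 2.
Proof.
move=> b0 xB; have [->|x0] := eqVneq x 0.
  by rewrite geodesic_radius0 powR0 ?gt_eqF// invr0 expr0n mulr0.
have r0 := radius_gt0 xB x0.
rewrite /radius_weight -powR_mulrn ?(ltW r0)// -powRN -powRD.
  by congr (_ `^ _); ring.
by rewrite (gt_eqF r0) implybT.
Qed.

End assembly.

Theorem theorem5p3 (R : realType) (n : nat) (beta : R) (n_ge4 : (4 <= n)%N)
    (beta_gt : -2 < beta) (beta_lt : beta < n%:R - 4) :
  exists C : R, 0 < C /\
    forall f : 'rV[R]_n -> R, test_function f ->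
      (integral_dVg (fun x =>
         (`|laplace_beltrami f x| ^+ 2 / geodesic_radius x `^ beta)%R)
       >=
       ((n%:R + beta) ^+ 2 * (n%:R - 4 - beta) ^+ 2 / 16)%:E *
         integral_dVg (fun x =>
           (`|f x| ^+ 2 / geodesic_radius x `^ (beta + 4))%R) +
       (3 * C * ((n%:R - 1) * (n%:R - 2) * (n%:R + beta) * (n%:R - 4 - beta)
         / 4))%:E *
         integral_dx (fun x =>
           (`|f x| ^+ 2 / geodesic_radius x `^ (beta + 2))%R))%E.
Proof.
case: n n_ge4 beta_lt => [|[|[|k]]]// k_gt0 beta_lt.
exists (1 / 3); split; first by rewrite divr_gt0.
move=> f tf; have [_ cK KB] := tf; set n := k.+3; set K := tsupport f in cK KB.
pose m : R := k.+1%:R.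
have nE : n%:R = m + 2 :> R by rewrite -natrD addn2.
have b4 : beta + 4 = beta + 2 + 2 by ring.
have s0 : 0 < beta + 2 + 2 by lra.
have s1 : beta + 2 + 2 < n%:R by rewrite /n; lra.
pose A : R := (n%:R + beta) * (n%:R - 4 - beta) / 4.
have A0 : 0 <= A.
  have n4 : 4 <= n%:R :> R by rewrite ler_nat.
  by rewrite divr_ge0// mulr_ge0//; rewrite /n; lra.
pose W : 'rV[R]_n -> R := radius_weight (beta + 2 + 2).
pose q1 x := f x ^+ 2 * conformal x ^+ n.
pose q2 x := f x ^+ 2 * geodesic_radius x ^+ 2.
pose d i x := div_density f k.+1 (beta + 2) (m / 2) i x.
pose q x := laplacian_density f x.
have f0 x : ~ K x -> f x = 0 by exact: notin_tsupport.
have closedK : closed K by exact: closed_tsupport.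
have aC := admissible_conformal cK KB; have aR := admissible_radius cK KB.
have aF : admissible K f by exact: admissible_test.
have iq1 : (lebesgue_rV R n).-integrable setT (fun x => (W x * q1 x)%:E).
  apply: (@integrable_weighted _ _ _ K) => //.
    by apply: admissibleM; exact: admissibleX.
  by move=> x /f0 fx; rewrite /q1 fx expr0n mul0r.
have iq2 : (lebesgue_rV R n).-integrable setT (fun x => (W x * q2 x)%:E).
  apply: (@integrable_weighted _ _ _ K) => //.
    by apply: admissibleM; exact: admissibleX.
  by move=> x /f0 fx; rewrite /q2 fx expr0n mul0r.
have q_notin x : ~ K x -> q x = 0.
  by move=> Kx; rewrite /q /laplacian_density (laplace_beltrami_notin Kx) expr0n !mul0r.
have aq : admissible K q.
  apply: admissibleM; last exact: admissibleX.
  apply: admissibleM; last exact: admissibleX.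
  by apply: admissibleX; exact: admissible_laplace_beltrami.
have iq : (lebesgue_rV R n).-integrable setT (fun x => (W x * q x)%:E).
  exact: (@integrable_weighted _ _ _ K).
have id i : (lebesgue_rV R n).-integrable setT (fun x => (W x * d i x)%:E).
  exact: integrable_div_density.
have d0 i : (\int[lebesgue_rV R n]_x (W x * d i x)%:E)%E = 0%E.
  exact: (@integral_div_density R n f tf k (beta + 2) (m / 2) erefl s0 s1 i).
have isd : (lebesgue_rV R n).-integrable setT (fun x => \sum_i (W x * d i x)%:E)%E.
  by apply: integrable_sum => // i _; exact: id.
pose c2 := A * (m + 1) * m.
have E1 : integral_dVg (fun x =>
      `|f x| ^+ 2 / geodesic_radius x `^ (beta + 4)) =
    (\int[lebesgue_rV R n]_x (W x * q1 x)%:E)%E.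
  rewrite /integral_dVg (integral_ball tf) => [|x /f0 ->]; last first.
    by rewrite normr0 expr0n !mul0r.
  apply: eq_integral => x _; congr EFin.
  by rewrite real_normK ?num_real// b4 /W /radius_weight powRN /q1 /conformal; ring.
have E2 : integral_dx (fun x =>
      `|f x| ^+ 2 / geodesic_radius x `^ (beta + 2)) =
    (\int[lebesgue_rV R n]_x (W x * q2 x)%:E)%E.
  rewrite (integral_ball tf) => [|x /f0 ->]; last by rewrite normr0 expr0n mul0r.
  apply: eq_integral => x _; congr EFin.
  have [Kx|/f0 fx] := pselect (K x); last first.
    by rewrite /q2 fx normr0 expr0n !mul0r mulr0.
  rewrite real_normK ?num_real// radius_power_eq//; last exact: KB.
    by rewrite /q2 /W; ring.
  by lra.
pose L x := `|laplace_beltrami f x| ^+ 2 / geodesic_radius x `^ beta *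
  conformal x ^+ n.
(* Outside the ball [conformal] can be negative, hence the restriction to [K]. *)
have c_ge0 x : K x -> 0 <= conformal x.
  by move=> /KB/conformal_ge2; exact: le_trans.
have L_ge0 x : 0 <= L x.
  have [Kx|/laplace_beltrami_notin fx] := pselect (K x); last first.
    by rewrite /L fx normr0 expr0n !mul0r.
  apply: mulr_ge0; last exact/exprn_ge0/c_ge0.
  by rewrite divr_ge0 ?exprn_ge0// powR_ge0.
(* At the origin [L] need not vanish: [0 `^ beta = 1] when [beta = 0]. *)
have LE x : L x = W x * q x + L 0 * \1_[set 0] x.
  have [->|x0] := eqVneq x 0.
    by rewrite indicE mem_set// mulr1 /W radius_weight0// mul0r add0r.
  rewrite indicE memNset ?mulr0 ?addr0; last exact/eqP.
  have [Kx|Kx] := pselect (K x).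
    by rewrite /L laplacian_weight_eq//; exact: KB.
  by rewrite q_notin// /L (laplace_beltrami_notin Kx) normr0 expr0n !mul0r mulr0.
have m0 := @measurable_rV_set1 R n 0.
have mWq : measurable_fun setT (fun x => W x * q x).
  by apply/measurable_EFinP; case/integrableP: iq.
(* By [LE] the integrands differ by a nonnegative term supported at the origin, so monotonicity of
   the integral suffices. *)
have E3 : (\int[lebesgue_rV R n]_x (W x * q x)%:E <= integral_dVg (fun x =>
    (`|laplace_beltrami f x| ^+ 2 / geodesic_radius x `^ beta)%R))%E.
  rewrite /integral_dVg (integral_ball tf) => [|x /laplace_beltrami_notin ->].
    apply: ge0_le_integral => //.
    - move=> x _; rewrite lee_fin mulr_ge0 ?radius_weight_ge0//.
      have [Kx|/q_notin -> //] := pselect (K x).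
      apply: mulr_ge0; last exact/exprn_ge0/c_ge0.
      by apply: mulr_ge0; exact: exprn_even_ge0.
    - exact/measurable_EFinP.
    - rewrite -/(conformal _) (_ : (fun x => _) = EFin \o L)//.
      apply/measurable_EFinP; rewrite (_ : L = fun x => W x * q x + L 0 * \1_[set 0] x).
        apply: measurable_funD => //; apply: measurable_funM; first exact: measurable_cst.
        exact: (measurable_indic m0).
      exact/funext.
    - move=> x _; rewrite lee_fin -/(conformal x) -/(L x) LE lerDl.
      by rewrite mulr_ge0.
  by rewrite normr0 expr0n !mul0r.
rewrite E1 E2; apply: le_trans E3.
have -> : (n%:R + beta) ^+ 2 * (n%:R - 4 - beta) ^+ 2 / 16 = A ^+ 2.
  by rewrite /A; field.
have -> : 3 * (1 / 3) * ((n%:R - 1) * (n%:R - 2) * (n%:R + beta) *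
    (n%:R - 4 - beta) / 4) = c2.
  by rewrite /c2 /A nE; field.
(* Adding [2 A] times the divergence, whose integral is 0, makes the two integrands comparable
   pointwise. *)
have -> : ((A ^+ 2)%:E * (\int[lebesgue_rV R n]_x (W x * q1 x)%:E) +
    c2%:E * (\int[lebesgue_rV R n]_x (W x * q2 x)%:E) =
  \int[lebesgue_rV R n]_x ((A ^+ 2)%:E * (W x * q1 x)%:E + c2%:E * (W x * q2 x)%:E
    + (2 * A)%:E * \sum_i (W x * d i x)%:E))%E.
  rewrite integralD//; last 2 first.
  - by apply: integrableD => //; exact: integrableZl.
  - exact: integrableZl.
  rewrite integralD//; [|exact: integrableZl|exact: integrableZl].
  rewrite !integralZl//= [X in ((2 * A)%:E * X)%E](_ : _ = 0%E) ?mule0 ?adde0//.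
  by rewrite integral_sum// big1.
apply: le_integral => //.
- apply: integrableD => //; last exact: integrableZl.
  by apply: integrableD => //; exact: integrableZl.
move=> x _; rewrite sumEFin -!EFinM -!EFinD lee_fin -mulr_sumr.
(* At the origin the weight [W] is 0, so both integrands vanish. *)
have [->|x0] := eqVneq x 0.
  by rewrite /W radius_weight0// !mul0r !mulr0 !addr0.
have [Kx|Kx] := pselect (K x); last first.
  rewrite q_notin// /q1 /q2 f0// expr0n !mul0r !mulr0 !add0r big1 ?mulr0// => i _.
  exact: div_density_notin.
rewrite [leLHS](_ : _ = W x * (A ^+ 2 * q1 x + c2 * q2 x + 2 * A * \sum_i d i x)).
  apply: ler_wpM2l; first exact: radius_weight_ge0.
  by apply: laplacian_density_ge => //; exact: KB.
by ring.
Qed.
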